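(* Let $f$ be a Hamiltonian stationary torus (setting in the context). Then every Darboux transform of $f$ which is given by a holomorphic section in $H^0_h$ with generic multiplier $h\in\mathrm{Spec}$ is again Hamiltonian stationary. More precisely, if $\beta$ is the Lagrangian angle of $f$, then every monochromatic Darboux transform $\hat f:T^2\to\mathbb R^4$ of $f$ has Lagrangian angle $\hat\beta=\beta+\beta_h$ with $\beta_h\in\mathbb R$ constant, i.e. its left normal is $\hat N=e^{j(\beta+\beta_h)}i$.
   Context: Identify $\mathbb R^4$ with $\mathbb H$, and $\mathbb C$ with $\mathrm{span}_{\mathbb R}\{1,i\}$; $\langle\cdot,\cdot\rangle$ is the Euclidean inner product on $\mathbb C\cong\mathbb R^2$. $\Gamma\subset\mathbb C$ a lattice, $T^2=\mathbb C/\Gamma$, $\Gamma^*$ the dual lattice. A Hamiltonian stationary torus is a $\Gamma$-periodic conformal immersion $f:\mathbb C\to\mathbb H$ with $df=e^{j\beta/2}dz\,g$, $dz=dx+i\,dy$, $g$ nowhere zero, $\beta(z)=2\pi\langle\beta_0,z\rangle$, $0\ne\beta_0\in\Gamma^*$ ($\beta$ is the Lagrangian angle). Convention $*dz=i\,dz$. The left normal of a conformal immersion $F$ is the map $N_F$ with $*dF=N_F\,dF$; for $f$, $N=e^{j\beta}i$. A conformal (branched) immersion is Hamiltonian stationary (Lagrangian w.r.t. left multiplication by $j$, with harmonic Lagrangian angle) iff its left normal is $e^{j\hat\beta}i$ with $\hat\beta$ real harmonic. A map $\alpha:\mathbb C\to\mathbb H$ is holomorphic if $*d\alpha=N\,d\alpha$;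 for a homomorphism $h:\Gamma\to\mathbb C_*$, $H^0_h$ is the complex space of holomorphic $\alpha$ with $\alpha(z+\gamma)=\alpha(z)h(\gamma)$; $\mathrm{Spec}=\{h: H^0_h\ne0\}$. ''Generic'' means outside the discrete set of $h\in\mathrm{Spec}$ with $\dim_{\mathbb C}H^0_h\ne1$. For $(A,B)\in\mathbb C^2$ let $h^{A,B}(\gamma)=e^{2\pi(\langle A,\gamma\rangle-i\langle B,\gamma\rangle)}$, $\Gamma^*_{A,B}=\{\delta\in\Gamma^*+\frac{\beta_0}2: |\delta-B|^2-|A|^2=\frac{|\beta_0|^2}4,\ \langle\delta-B,A\rangle=0\}$, $e_\delta(z)=e^{2\pi i\langle\delta,z\rangle}$, $\lambda_\delta=\frac2{\beta_0}(\delta-iA-B)$. A holomorphic section with multiplier is monochromatic if it equals $\alpha_\delta c$, $c\in\mathbb C_*$, where $\alpha_\delta=e^{j\beta/2}(1-k\lambda_\delta)e_{\delta-B}e^{2\pi\langle A,\cdot\rangle}$ for some $(A,B)$ and $\delta\in\Gamma^*_{A,B}$. Darboux transform given by a nowhere vanishing holomorphic $\alpha$ with multiplier: let $\hat T:\mathbb C\to\mathbb H$ be defined by $d\alpha=-df\,\hat T\alpha$ and put $\nu=\hat T\alpha$; the Darboux transform is $\hat f=[f\nu+\alpha:\nu]\in\mathbb{HP}^1=S^4$, which equals $f+\hat T^{-1}$ where $\hat T\ne0$. It is monochromatic if $\alpha$ is monochromatic. *)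

(* Defs.v *)
From HB Require Import structures.
From mathcomp Require Import all_boot all_order all_algebra.
From mathcomp Require Import all_classical all_reals all_analysis.

Set Implicit Arguments.
Unset Strict Implicit.
Unset Printing Implicit Defensive.

Import Order.TTheory GRing.Theory Num.Theory.
Import numFieldNormedType.Exports.
Local Open Scope ring_scope.

Section Defs.
Variable R : realType.

Definition quat := 'rV[R]_4.
(* points of C = R^2, components (Re, Im) *)
Definition cpt := 'rV[R]_2.

Definition qmk (a b c d : R) : quat := \row_(n < 4) [:: a; b; c; d]`_n.
Definition qc (q : quat) (n : nat) : R := q 0 (inord n).

Definition qmul (p q : quat) : quat :=
  qmk (qc p 0 * qc q 0 - qc p 1 * qc q 1 - qc p 2 * qc q 2 - qc p 3 * qc q 3)
      (qc p 0 * qc q 1 + qc p 1 * qc q 0 + qc p 2 * qc q 3 - qc p 3 * qc q 2)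
      (qc p 0 * qc q 2 - qc p 1 * qc q 3 + qc p 2 * qc q 0 + qc p 3 * qc q 1)
      (qc p 0 * qc q 3 + qc p 1 * qc q 2 - qc p 2 * qc q 1 + qc p 3 * qc q 0).

Definition qconj (q : quat) : quat := qmk (qc q 0) (- qc q 1) (- qc q 2) (- qc q 3).
Definition qnorm2 (q : quat) : R := qc q 0 ^+ 2 + qc q 1 ^+ 2 + qc q 2 ^+ 2 + qc q 3 ^+ 2.
(* quaternionic inverse (0^-1 = 0 by the convention of ^-1 on R) *)
Definition qinv (q : quat) : quat := (qnorm2 q)^-1 *: qconj q.

Definition qreal (r : R) : quat := qmk r 0 0 0.
Definition qi : quat := qmk 0 1 0 0.
Definition qj : quat := qmk 0 0 1 0.
Definition qk : quat := qmk 0 0 0 1.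

Definition ej (t : R) : quat := qmk (cos t) 0 (sin t) 0.
Definition ei (t : R) : quat := qmk (cos t) (sin t) 0 0.

Definition cplx (z : cpt) : quat := qmk (z 0 0) (z 0 1) 0 0.
Definition is_cplx (q : quat) : Prop := qc q 2 = 0 /\ qc q 3 = 0.

Definition row2 (x y : R) : cpt := \row_(n < 2) [:: x; y]`_n.
Definition ip (a b : cpt) : R := a 0 0 * b 0 0 + a 0 1 * b 0 1.
Definition e1 : cpt := row2 1 0.
Definition e2 : cpt := row2 0 1.

Definition lattice_basis (w1 w2 : cpt) : Prop :=
  w1 0 0 * w2 0 1 - w1 0 1 * w2 0 0 != 0.
Definition inLat (w1 w2 : cpt) (g : cpt) : Prop :=
  exists m n : int, g = m%:~R *: w1 + n%:~R *: w2.
Definition inDual (w1 w2 : cpt) (d : cpt) : Prop :=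
  forall g, inLat w1 w2 g -> exists k : int, ip d g = k%:~R.

Fixpoint Ck {W : normedModType R} (k : nat) (F : cpt -> W) : Prop :=
  match k with
  | 0 => continuous F
  | k'.+1 => (forall z, derivable F z e1 /\ derivable F z e2) /\
             Ck k' ('D_e1 F) /\ Ck k' ('D_e2 F)
  end.
Definition smooth {W : normedModType R} (F : cpt -> W) : Prop := forall k, Ck k F.

Definition harmonic (b : cpt -> R) : Prop :=
  smooth b /\ forall z, 'D_e1 ('D_e1 b) z + 'D_e2 ('D_e2 b) z = 0.

(* ---------- Left normal: *dF = N dF at z, with *dz = i dz,
   i.e. *(a dx + b dy) = b dx - a dy ---------- *)
Definition left_normal_at (F : cpt -> quat) (N : quat) (z : cpt) : Prop :=
  [/\ derivable F z e1, derivable F z e2,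
      'D_e2 F z = qmul N ('D_e1 F z) &
      - 'D_e1 F z = qmul N ('D_e2 F z)].

Definition lag_angle (b0 : cpt) (z : cpt) : R := 2 * pi * ip b0 z.

(* f : C -> H is Gamma-periodic, smooth, and df = e^{j beta/2} dz g with g nowhere zero *)
Definition HS_torus (w1 w2 b0 : cpt) (f : cpt -> quat) : Prop :=
  [/\ b0 != 0, inDual w1 w2 b0, smooth f,
      (forall z g, inLat w1 w2 g -> f (z + g) = f z) &
      exists g : cpt -> quat, forall z,
        [/\ g z != 0,
            'D_e1 f z = qmul (ej (lag_angle b0 z / 2)) (g z) &
            'D_e2 f z = qmul (ej (lag_angle b0 z / 2)) (qmul qi (g z))]].

Definition normal_f (b0 : cpt) (z : cpt) : quat := qmul (ej (lag_angle b0 z)) qi.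

Definition holomorphic (b0 : cpt) (a : cpt -> quat) : Prop :=
  smooth a /\ forall z,
    'D_e2 a z = qmul (normal_f b0 z) ('D_e1 a z) /\
    - 'D_e1 a z = qmul (normal_f b0 z) ('D_e2 a z).

Definition multiplier (w1 w2 : cpt) (h : cpt -> cpt) : Prop :=
  (forall g, inLat w1 w2 g -> h g != 0) /\
  (forall g g', inLat w1 w2 g -> inLat w1 w2 g' ->
     cplx (h (g + g')) = qmul (cplx (h g)) (cplx (h g'))).

Definition in_H0 (w1 w2 b0 : cpt) (h : cpt -> cpt) (a : cpt -> quat) : Prop :=
  holomorphic b0 a /\
  forall z g, inLat w1 w2 g -> a (z + g) = qmul (a z) (cplx (h g)).

Definition dimC_H0_one (w1 w2 b0 : cpt) (h : cpt -> cpt) : Prop :=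
  exists a0, [/\ in_H0 w1 w2 b0 h a0, a0 != (fun _ => 0) &
    forall a, in_H0 w1 w2 b0 h a -> exists c : cpt, forall z, a z = qmul (a0 z) (cplx c)].

Definition generic_spec (w1 w2 b0 : cpt) (h : cpt -> cpt) : Prop :=
  dimC_H0_one w1 w2 b0 h.

Definition in_GammaAB (w1 w2 b0 A B d : cpt) : Prop :=
  [/\ inDual w1 w2 (d - (2%:R)^-1 *: b0),
      ip (d - B) (d - B) - ip A A = ip b0 b0 / 4 &
      ip (d - B) A = 0].

Definition lambda_d (b0 A B d : cpt) : quat :=
  qmul (qreal 2) (qmul (cplx d - qmul qi (cplx A) - cplx B) (qinv (cplx b0))).

Definition alpha_d (b0 A B d : cpt) (z : cpt) : quat :=
  qmul (ej (lag_angle b0 z / 2))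
    (qmul (qreal 1 - qmul qk (lambda_d b0 A B d))
       (qmul (ei (2 * pi * ip (d - B) z)) (qreal (expR (2 * pi * ip A z))))).

Definition monochromatic (w1 w2 b0 : cpt) (a : cpt -> quat) : Prop :=
  exists A B d c : cpt,
    [/\ in_GammaAB w1 w2 b0 A B d, c != 0 &
        forall z, a z = qmul (alpha_d b0 A B d z) (cplx c)].

Definition nowhere_zero (a : cpt -> quat) : Prop := forall z, a z != 0.

Definition darboux_T (f a T : cpt -> quat) : Prop :=
  forall z, 'D_e1 a z = - qmul ('D_e1 f z) (qmul (T z) (a z)) /\
            'D_e2 a z = - qmul ('D_e2 f z) (qmul (T z) (a z)).

(* affine part of f-hat = [f nu + alpha : nu]: equals f + T^-1 where T <> 0 *)
Definition darboux (f T : cpt -> quat) (z : cpt) : quat := f z + qinv (T z).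

(* Hamiltonian stationary (on the part of f-hat in R^4 = H, i.e. where T <> 0):
   left normal e^{j bh} i with bh real harmonic *)
Definition HS_off (F : cpt -> quat) (U : cpt -> Prop) : Prop :=
  exists bh : cpt -> R, harmonic bh /\
    forall z, U z -> left_normal_at F (qmul (ej (bh z)) qi) z.

End Defs.

Arguments qi {R}.
Arguments qj {R}.
Arguments qk {R}.
Arguments e1 {R}.
Arguments e2 {R}.

(* Main.v *)
Require Import Defs.
From HB Require Import structures.
From mathcomp Require Import all_boot all_order all_algebra.
From mathcomp Require Import ring lra.
From mathcomp Require Import all_classical all_reals all_analysis.
Import Order.TTheory GRing.Theory Num.Theory.
Import numFieldNormedType.Exports.
Local Open Scope ring_scope.

(* The left normal [e^{j beta} i] of [f] is rotated by [e^{-j beta(t)/2}] when [z] is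
   translated by [t], so translations act on [H^0_h]: if [a] is a section then so is
   [e^{-j beta(t)/2} a(z + t)].  When [dim H^0_h = 1] this forces
   [a = e^{j beta/2} q x] with [x] complex valued, [x(0) = 1], and
   [da = (j dbeta/2) a + a m] for a constant complex one-form [m]; monochromatic
   sections visibly have the same shape.

   For such [a], with [E = e^{j beta/2}], one gets [a_x = E S E^-1 a] for a constant
   quaternion [S], and then [f_x T = - E S E^-1], so that either [T] vanishes identically
   or the Darboux transform is [f - W f_x] with [W = E S^-1 E^-1].  Differentiating, and
   using [f_xy = f_yx], its left normal is [W (e^{j beta} i) W^-1].  Holomorphicity of
   [a] says that [S - p1 j] and [i S - p2 j] commute ([p1], [p2] the partial derivatives
   of [beta/2]), since both lie in [q C q^-1]; the [j]-component of this relation says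
   that [S^-1 i S] has no [j]-component, i.e. [S^-1 i S = e^{j t} i] for some real [t]. *)

(** * Quaternions in coordinates *)

Section Quaternions.
Set Implicit Arguments.
Unset Strict Implicit.
Context {R : realType}.
Implicit Types p q r : quat R.

Lemma qc_qmk (a b c d : R) :
  (qc (qmk a b c d) 0 = a) * (qc (qmk a b c d) 1 = b) *
  (qc (qmk a b c d) 2 = c) * (qc (qmk a b c d) 3 = d).
Proof. by rewrite /qc /qmk !mxE /= !inordK. Qed.

Lemma qcD p q n : qc (p + q) n = qc p n + qc q n. Proof. by rewrite /qc mxE. Qed.
Lemma qcN p n : qc (- p) n = - qc p n. Proof. by rewrite /qc mxE. Qed.
Lemma qcZ (k : R) p n : qc (k *: p) n = k * qc p n. Proof. by rewrite /qc mxE. Qed.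
Lemma qc0 n : qc (0 : quat R) n = 0. Proof. by rewrite /qc mxE. Qed.

Lemma quatP p q : [/\ qc p 0 = qc q 0, qc p 1 = qc q 1, qc p 2 = qc q 2 &
  qc p 3 = qc q 3] -> p = q.
Proof.
rewrite /qc => -[h0 h1 h2 h3]; apply/rowP => i.
rewrite -(inord_val i); case: i => -[|[|[|[|]]]] //=.
Qed.

Lemma qc_qmul p q :
  (qc (qmul p q) 0 = qc p 0 * qc q 0 - qc p 1 * qc q 1 - qc p 2 * qc q 2 - qc p 3 * qc q 3) *
  (qc (qmul p q) 1 = qc p 0 * qc q 1 + qc p 1 * qc q 0 + qc p 2 * qc q 3 - qc p 3 * qc q 2) *
  (qc (qmul p q) 2 = qc p 0 * qc q 2 - qc p 1 * qc q 3 + qc p 2 * qc q 0 + qc p 3 * qc q 1) *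
  (qc (qmul p q) 3 = qc p 0 * qc q 3 + qc p 1 * qc q 2 - qc p 2 * qc q 1 + qc p 3 * qc q 0).
Proof. by rewrite /qmul !qc_qmk. Qed.

Definition qcE := (qc_qmul, qcD, qcN, qcZ, qc0, qc_qmk).
End Quaternions.

Ltac qring := (refine (@quatP _ _ _ _); rewrite ?qcE; split; ring).

(** * Quaternion algebra, the circle [ej], and conjugates of [i] *)

Section QuaternionAlgebra.
Set Implicit Arguments.
Unset Strict Implicit.
Context {R : realType}.
Implicit Types p q r : quat R.

Lemma qmulA p q r : qmul p (qmul q r) = qmul (qmul p q) r.
Proof. qring. Qed.
Lemma qmulDl p q r : qmul (p + q) r = qmul p r + qmul q r.
Proof. qring. Qed.
Lemma qmulDr p q r : qmul p (q + r) = qmul p q + qmul p r.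
Proof. qring. Qed.
Lemma qmulNl p q : qmul (- p) q = - qmul p q.
Proof. qring. Qed.
Lemma qmulNr p q : qmul p (- q) = - qmul p q.
Proof. qring. Qed.
Lemma qmulZl (k : R) p q : qmul (k *: p) q = k *: qmul p q.
Proof. qring. Qed.
Lemma qmulZr (k : R) p q : qmul p (k *: q) = k *: qmul p q.
Proof. qring. Qed.
Lemma qmul0l p : qmul 0 p = 0.
Proof. qring. Qed.
Lemma qmul0r p : qmul p 0 = 0.
Proof. qring. Qed.
Lemma qmul1l p : qmul (qreal 1) p = p.
Proof. by rewrite /qreal; qring. Qed.
Lemma qmul1r p : qmul p (qreal 1) = p.
Proof. by rewrite /qreal; qring. Qed.

Lemma qnorm2_eq0 p : (qnorm2 p == 0) = (p == 0).
Proof.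
apply/eqP/eqP => [|->]; last by rewrite /qnorm2 !qcE expr0n /= !addr0.
rewrite /qnorm2 => /eqP.
rewrite !paddr_eq0 ?addr_ge0 ?sqr_ge0// !sqrf_eq0.
move=> /andP[/andP[/andP[/eqP h0 /eqP h1] /eqP h2] /eqP h3].
by apply: quatP; rewrite ?qcE.
Qed.

Lemma qmulV p : p != 0 -> qmul p (qinv p) = qreal 1.
Proof.
rewrite -qnorm2_eq0 => p0; rewrite /qinv qmulZr.
suff -> : qmul p (qconj p) = qnorm2 p *: qreal 1.
  by rewrite scalerA mulVf// scale1r.
by rewrite /qconj /qreal /qnorm2; qring.
Qed.

Lemma qmulVl p : p != 0 -> qmul (qinv p) p = qreal 1.
Proof.
rewrite -qnorm2_eq0 => p0; rewrite /qinv qmulZl.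
suff -> : qmul (qconj p) p = qnorm2 p *: qreal 1.
  by rewrite scalerA mulVf// scale1r.
by rewrite /qconj /qreal /qnorm2; qring.
Qed.

Lemma qreal1_neq0 : qreal 1 != 0 :> quat R.
Proof.
by apply/eqP => /(congr1 (fun q => qc q 0)); rewrite /qreal !qcE => /eqP; rewrite oner_eq0.
Qed.

Lemma qmulI p q r : p != 0 -> qmul p q = qmul p r -> q = r.
Proof.
move=> p0 e; have := congr1 (qmul (qinv p)) e.
by rewrite !qmulA qmulVl// !qmul1l.
Qed.

Lemma qmulIr p q r : p != 0 -> qmul q p = qmul r p -> q = r.
Proof.
move=> p0 e; have := congr1 (fun x => qmul x (qinv p)) e.
by rewrite -!qmulA qmulV// !qmul1r.
Qed.

Lemma qinv_unique p q : qmul p q = qreal 1 -> qinv p = q.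
Proof.
move=> pq; have p0 : p != 0.
  by apply: contra_eqN pq => /eqP ->; rewrite qmul0l eq_sym qreal1_neq0.
by apply: (qmulI p0); rewrite qmulV.
Qed.

Lemma qnorm2M p q : qnorm2 (qmul p q) = qnorm2 p * qnorm2 q.
Proof. by rewrite /qnorm2 !qcE; ring. Qed.

Lemma ej0 : ej 0 = qreal 1 :> quat R.
Proof. by rewrite /ej cos0 sin0. Qed.

Lemma ejD (s t : R) : ej (s + t) = qmul (ej s) (ej t).
Proof. by rewrite /ej cosD sinD; qring. Qed.

Lemma ejNK (t : R) : (qmul (ej (- t)) (ej t) = qreal 1) * (qmul (ej t) (ej (- t)) = qreal 1).
Proof. by rewrite -!ejD addNr addrN ej0. Qed.

Lemma ej_neq0 (t : R) : ej t != 0.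
Proof.
apply/eqP => e; have := (ejNK t).2; rewrite e qmul0l => /eqP.
by rewrite eq_sym (negPf qreal1_neq0).
Qed.

Lemma ej_qj (t : R) : qmul (ej t) qj = qmul qj (ej t).
Proof. by rewrite /ej /qj; qring. Qed.

Lemma qi_ej (t : R) : qmul qi (ej t) = qmul (ej (- t)) qi.
Proof. by rewrite /ej /qi cosN sinN; qring. Qed.

Lemma qi_sqr : qmul qi qi = - qreal 1 :> quat R.
Proof. by rewrite /qi /qreal; qring. Qed.

(** As [i] anticommutes with [j], moving half of the rotation across [i] inverts it. The left normal
    of [f] thus becomes the conjugate of the constant [i] by [e^{j beta/2}]. *)
Lemma ej_split (t : R) : qmul (ej t) qi = qmul (ej (t / 2)) (qmul qi (ej (- (t / 2)))).
Proof. by rewrite qi_ej opprK qmulA -ejD -splitr. Qed.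

(** [acos] only yields angles with nonnegative sine, so the sign of [y] decides between [acos x] and
    its opposite. *)
Lemma ej_angle (x y : R) : x ^+ 2 + y ^+ 2 = 1 ->
  exists t : R, cos t = x /\ sin t = y.
Proof.
move=> xy; have xB : -1 <= x <= 1.
  by rewrite -ler_norml -(@ler_pXn2r _ 2)// ?nnegrE// expr1n real_normK ?num_real//
    -xy lerDl sqr_ge0.
have e : Num.sqrt (1 - x ^+ 2) = `|y| by rewrite -xy [x ^+ 2 + _]addrC addrK sqrtr_sqr.
have cK : cos (acos x) = x by rewrite acosK// in_itv.
have [y0|y0] := leP 0 y.
  by exists (acos x); rewrite sin_acos// e ger0_norm.
by exists (- acos x); rewrite cosN sinN sin_acos// e ltr0_norm// opprK.
Qed.

Lemma cplxM_comm (x y : cpt R) : qmul (cplx x) (cplx y) = qmul (cplx y) (cplx x).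
Proof. by rewrite /cplx; qring. Qed.

Lemma row2E (x y : R) : (row2 x y 0 0 = x) * (row2 x y 0 1 = y).
Proof. by rewrite /row2 !mxE. Qed.

Lemma cplx_row2 q : qc q 2 = 0 -> qc q 3 = 0 -> q = cplx (row2 (qc q 0) (qc q 1)).
Proof. by move=> q2 q3; apply: quatP; rewrite /cplx !qcE !row2E. Qed.

Lemma cplxV (x : cpt R) : qinv (cplx x) = cplx (row2 (qc (qinv (cplx x)) 0) (qc (qinv (cplx x)) 1)).
Proof. by apply: cplx_row2; rewrite /qinv /qconj /cplx !qcE oppr0 mulr0. Qed.

Lemma cplxM (x y : cpt R) : qmul (cplx x) (cplx y) =
  cplx (row2 (qc (qmul (cplx x) (cplx y)) 0) (qc (qmul (cplx x) (cplx y)) 1)).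
Proof. by apply: cplx_row2; rewrite /cplx !qcE; ring. Qed.

(** This compares the coefficients of [f_x] in the left normal equation of [f - W f_x]. Multiplying
    by [S] on both sides removes [W] and leaves a polynomial identity. *)
Lemma conj_normal_identity (S W N : quat R) (p1 p2 : R) :
  qmul W S = qreal 1 -> qmul S W = qreal 1 -> qc N 0 = 0 -> qc N 2 = 0 ->
  qmul (S - p1 *: qj) (qmul N S - p2 *: qj) =
    qmul (qmul N S - p2 *: qj) (S - p1 *: qj) ->
  N - (p2 *: (qmul qj W - qmul W qj) + qmul W ((2 * p1) *: qmul qj N)) =
  qmul (qmul W (qmul N S)) (qreal 1 - p1 *: (qmul qj W - qmul W qj)).
Proof.
move=> WS SW N0 N2 comm.
have S0 : S != 0.
  by apply: contra_eqN WS => /eqP ->; rewrite qmul0r eq_sym qreal1_neq0.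
apply: (qmulI S0); apply: (qmulIr S0).
have jW : qmul (qmul S (qmul qj W - qmul W qj)) S = qmul S qj - qmul qj S.
  rewrite qmulDr qmulNr qmulDl qmulNl -!qmulA WS qmul1r.
  by rewrite (qmulA S W) SW qmul1l.
have jW' : qmul (qmul S (qmul (qmul W (qmul N S))
      (qreal 1 - p1 *: (qmul qj W - qmul W qj)))) S =
    qmul (qmul N S) S - p1 *: qmul N (qmul S qj - qmul qj S).
  rewrite -jW !qmulA SW qmul1l.
  by rewrite !(qmulDr, qmulDl, qmulNl, qmulNr, qmulZl, qmulZr) qmul1r !qmulA.
rewrite jW' !(qmulDr, qmulDl, qmulNl, qmulNr) !(qmulZl, qmulZr) jW.
rewrite !qmulA SW qmul1l.
apply/eqP; rewrite -subr_eq0; apply/eqP.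
(* The difference of the two sides is exactly the commutator in [comm]: [N] has only [i] and [k]
   components, hence anticommutes with [j]. *)
move/eqP : comm; rewrite -subr_eq0 => /eqP <-.
apply: quatP; rewrite /qj ?qcE N0 N2.
move: (qc S 0) (qc S 1) (qc S 2) (qc S 3) (qc N 1) (qc N 3) => s0 s1 s2 s3 n1 n3.
clear; split; ring.
Qed.

(** [S^-1 i S] is a unit quaternion without real part. Once its [j]-component is known to vanish, it
    lies on the circle of the points [e^{jt} i = cos t i - sin t k]. *)
Lemma conj_qi_angle (S : quat R) (p1 p2 : R) : S != 0 ->
  qmul (S - p1 *: qj) (qmul qi S - p2 *: qj) =
    qmul (qmul qi S - p2 *: qj) (S - p1 *: qj) ->
  exists t : R, qmul (qinv S) (qmul qi S) = qmul (ej t) qi.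
Proof.
move=> S0 comm; set Q := qmul _ _.
have Q0 : qc Q 0 = 0.
  by rewrite /Q /qinv qmulZl qcZ /qi /qconj !qcE; ring.
have Q2 : qc Q 2 = 0.
  rewrite /Q /qinv qmulZl qcZ /qi /qconj !qcE.
  (* A commutator with [j] has no [j]-component, so [p1] and [p2] cancel here and only the
     commutator of [S] and [i S] contributes. *)
  have := congr1 (fun q => qc q 2) comm.
  rewrite /qi /qj !qcE => c2.
  have {}c2 : qc S 0 * qc S 3 = qc S 1 * qc S 2.
    apply: (@mulfI _ 2); first by rewrite pnatr_eq0.
    apply/eqP; rewrite -subr_eq0; apply/eqP.
    move/eqP : c2; rewrite -subr_eq0 => /eqP <-; ring.
  transitivity ((qnorm2 S)^-1 * (2 * (qc S 1 * qc S 2 - qc S 0 * qc S 3))); first ring.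
  by rewrite c2; ring.
have nQ : qnorm2 Q = 1.
  have : qmul S Q = qmul qi S by rewrite /Q qmulA qmulV// qmul1l.
  move/(congr1 (@qnorm2 R)); rewrite !qnorm2M mulrC => e.
  apply: (@mulIf _ (qnorm2 S)); first by rewrite qnorm2_eq0.
  by rewrite e; congr (_ * _); rewrite /qnorm2 /qi !qcE; ring.
have [t [ct st]] : exists t : R, cos t = qc Q 1 /\ sin t = - qc Q 3.
  apply: ej_angle; rewrite -nQ /qnorm2 Q0 Q2; ring.
exists t; clearbody Q; apply: quatP; rewrite /ej /qi !qcE ct st Q0 Q2; split; ring.
Qed.

End QuaternionAlgebra.

(** * Directional derivatives and symmetry of mixed derivatives *)

Section LineDerivatives.
Set Implicit Arguments.
Unset Strict Implicit.
Context {R : realType} {V : normedModType R}.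

(** Both sides have the same difference quotient. This gives access to the one-variable mean value
    theorem and chain rule along lines. *)
Lemma is_derive_line (W : normedModType R) (F : V -> W) (x v : V) (s : R) D :
  is_derive (s *: v + x) v F D <->
  is_derive s 1 (fun h : R => F (h *: v + x)) D.
Proof.
have e : (fun h : R => h^-1 *: ((F \o shift (s *: v + x)) (h *: v) - F (s *: v + x))) =
  (fun h : R => h^-1 *: (((fun h => F (h *: v + x)) \o shift s) (h *: 1) - F (s *: v + x))).
  by apply/funext => h /=; rewrite addrA -scalerDl [h *: 1]mulr1.
by split => -[d1 d2]; split; move: d1 d2; rewrite /derivable /derive e.
Qed.

Lemma is_derive_shiftr (W : normedModType R) (F : V -> W) (x t v : V) D :
  is_derive (x + t) v F D <-> is_derive x v (fun y => F (y + t)) D.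
Proof.
have e : (fun h : R => h^-1 *: ((F \o shift (x + t)) (h *: v) - F (x + t))) =
  (fun h : R => h^-1 *: (((fun y => F (y + t)) \o shift x) (h *: v) - F (x + t))).
  by apply/funext => h /=; rewrite addrA.
by split => -[d1 d2]; split; move: d1 d2; rewrite /derivable /derive e.
Qed.

Lemma is_derive_mxP m n (M : V -> 'M[R]_(m.+1, n.+1)) (x v : V) D :
  is_derive x v M D <-> forall i j, is_derive x v (fun t => M t i j) (D i j).
Proof.
split => [[d1 <-] i j|d].
  split; first exact: (derivable_mxP M x v).1.
  by rewrite derive_mx// mxE.
have dM : derivable M x v by apply/derivable_mxP => i j; have [] := d i j.
split => //; rewrite derive_mx//; apply/matrixP => i j; rewrite mxE.
by have [_ ->] := d i j.
Qed.

Lemma MVT_line (F : V -> R) (x v : V) (h : R) : 0 < h ->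
  (forall y, derivable F y v) ->
  exists2 c, 0 < c < h & F (h *: v + x) - F x = 'D_v F (c *: v + x) * h.
Proof.
move=> h0 dF.
pose g (s : R) := F (s *: v + x).
have dg (s : R) : is_derive s 1 g ('D_v F (s *: v + x)).
  by apply/is_derive_line; apply: derivableP.
have cg : {within `[0, h], continuous g}%classic.
  apply: continuous_subspaceT => s; apply/differentiable_continuous/derivable1_diffP.
  by have [] := dg s.
have [c] := @MVT _ g (fun s => 'D_v F (s *: v + x)) 0 h h0 (fun s _ => dg s) cg.
by rewrite in_itv /= /g scale0r add0r subr0 => c0h e; exists c.
Qed.

(** The mean value theorem is used twice: along [u] for the increment [F (h v + y) - F y], then
    along [v] for ['D_u F]. *)
Lemma second_difference (F : V -> R) (x u v : V) (h : R) : 0 < h ->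
  (forall y, derivable F y u) -> (forall y, derivable ('D_u F) y v) ->
  exists c d, [/\ 0 < c < h, 0 < d < h &
  F (h *: u + (h *: v + x)) - F (h *: u + x) - F (h *: v + x) + F x =
    'D_v ('D_u F) (d *: v + (c *: u + x)) * h * h].
Proof.
move=> h0 dF ddF.
pose G y := F (h *: v + y) - F y.
have dG y : is_derive y u G ('D_u F (h *: v + y) - 'D_u F y).
  apply: is_deriveB; last exact: derivableP.
  rewrite (_ : (fun _ => _) = (fun z => F (z + h *: v))); last first.
    by apply/funext => z; rewrite addrC.
  by apply/is_derive_shiftr; rewrite addrC; apply: derivableP.
have dG' y : derivable G y u by have [] := dG y.
have [c c0h e] := @MVT_line G x u h h0 dG'.
have [d d0h e'] := @MVT_line ('D_u F) (c *: u + x) v h h0 ddF.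
exists c, d; split => //.
rewrite -e' -(@derive_val _ _ _ _ _ _ _ (dG _)) -e /G.
rewrite (addrCA (h *: v)); ring.
Qed.

(** The second difference is symmetric in [u] and [v], so the two mixed derivatives take a common
    value at two points close to [x]; continuity at [x] brings both within [e / 2] of that value. *)
Lemma schwarz (F : V -> R) (x u v : V) :
  (forall y, derivable F y u) -> (forall y, derivable F y v) ->
  (forall y, derivable ('D_u F) y v) -> (forall y, derivable ('D_v F) y u) ->
  {for x, continuous ('D_v ('D_u F))} -> {for x, continuous ('D_u ('D_v F))} ->
  'D_v ('D_u F) x = 'D_u ('D_v F) x.
Proof.
move=> du dv duv dvu cuv cvu.
set A := 'D_v ('D_u F); set B := 'D_u ('D_v F).
apply/eqP; rewrite -subr_eq0 -normr_le0; apply/ler_addgt0Pl => e e0; rewrite addr0.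
have e2 : 0 < e / 2 by rewrite divr_gt0.
have /cvgrPdist_lt /(_ _ e2) nA := cuv.
have /cvgrPdist_lt /(_ _ e2) nB := cvu.
have /nbhs_ballP[r /= r0 rAB] : nbhs x (fun y => `|A x - A y| < e / 2 /\ `|B x - B y| < e / 2).
  exact: (filterI nA nB).
(* With this step size every [d v + c u] with [c], [d] in []0, h[] has norm below [r]; the summand 1
   keeps the denominator positive. *)
pose h := r / (1 + `|u| + `|v|).
have n0 : 0 < 1 + `|u| + `|v| by rewrite -addrA ltr_pwDl// addr_ge0.
have h0 : 0 < h by rewrite divr_gt0.
have near_x (c d : R) : 0 < c < h -> 0 < d < h ->
    `|A x - A (d *: v + (c *: u + x))| < e / 2 /\
    `|B x - B (c *: u + (d *: v + x))| < e / 2.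
  move=> /andP[c0 ch] /andP[d0 dh].
  have small : `|d *: v + c *: u| < r.
    rewrite (le_lt_trans (ler_normD _ _))// !normrZ !gtr0_norm//.
    have : d * `|v| <= h * `|v| by rewrite ler_wpM2r// ltW.
    have : c * `|u| <= h * `|u| by rewrite ler_wpM2r// ltW.
    have : h * (1 + `|u| + `|v|) = r by rewrite /h divfK// gt_eqF.
    by rewrite !mulrDr mulr1; lra.
  by split; [apply: (rAB _ _).1|apply: (rAB _ _).2];
    rewrite -ball_normE /= addrA opprD addrCA subrr addr0 normrN // addrC.
have [c [d [c0 d0 E1]]] := @second_difference F x u v h h0 du duv.
have [c' [d' [c0' d0' E2]]] := @second_difference F x v u h h0 dv dvu.
(* Both values times [h * h] equal the same second difference. *)
have AB : A (d *: v + (c *: u + x)) = B (d' *: u + (c' *: v + x)).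
  have hh : h != 0 by rewrite gt_eqF.
  apply: (mulIf hh); apply: (mulIf hh).
  apply: (etrans (esym E1)); apply: (etrans _ E2).
  by rewrite (addrCA (h *: u) (h *: v) x); congr (_ + _); rewrite addrAC.
have [nA' _] := near_x _ _ c0 d0.
have [_ nB'] := near_x _ _ d0' c0'.
rewrite -/A -/B; apply: ltW; rewrite [ltRHS]splitr.
apply: le_lt_trans (ler_distD (A (d *: v + (c *: u + x))) _ _) _.
apply: ltrD; first exact: nA'.
by rewrite AB distrC; exact: nB'.
Qed.

End LineDerivatives.

(** * Calculus of quaternion-valued maps *)

Section QuaternionCalculus.
Set Implicit Arguments.
Unset Strict Implicit.
Context {R : realType} {V : normedModType R}.
Implicit Types (F G : V -> quat R) (x v : V).

(** Only a derivative of [g] along [v] is given, so the argument restricts to the line through [x]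
    in direction [v]. *)
Lemma is_derive_chain (f : R -> R) (g : V -> R) x v (a b : R) :
  is_derive x v g b -> is_derive (g x) 1 f a -> is_derive x v (f \o g) (a * b).
Proof.
move=> dg df.
have x0 : 0 *: v + x = x by rewrite scale0r add0r.
have dg0 : is_derive (0 : R) 1 (fun h : R => g (h *: v + x)) b.
  by apply: (is_derive_line g x v 0 b).1; rewrite x0.
have df0 : is_derive (g (0 *: v + x)) 1 f a by rewrite x0.
have := @is_derive1_comp _ f (fun h : R => g (h *: v + x)) 0 a b df0 dg0.
by move=> /(is_derive_line (f \o g) x v 0 (a * b)).2; rewrite x0.
Qed.

Lemma is_derive_qcP F x v D : is_derive x v F D <->
  forall n, is_derive x v (fun t => qc (F t) n) (qc D n).
Proof.
split => [d n|d]; first exact: (is_derive_mxP F x v D).1.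
apply/is_derive_mxP => i j; rewrite (ord1 i) -(inord_val j).
exact: d.
Qed.

Lemma is_derive_qmul F G x v dF dG : is_derive x v F dF -> is_derive x v G dG ->
  is_derive x v (fun t => qmul (F t) (G t)) (qmul dF (G x) + qmul (F x) dG).
Proof.
move=> /is_derive_qcP dF' /is_derive_qcP dG'.
have dM m n : is_derive x v (fun t => qc (F t) m * qc (G t) n)
    (qc (F x) m * qc dG n + qc (G x) n * qc dF m).
  exact: is_deriveM.
apply/is_derive_mxP => i j; rewrite (ord1 i).
have -> : (qmul dF (G x) + qmul (F x) dG) 0 j =
  qc (qmul dF (G x) + qmul (F x) dG) j by rewrite /qc inord_val.
case: j => -[|[|[|[|]]]] // j4 /=.
- rewrite (_ : (fun t => _) = (fun t => qc (F t) 0 * qc (G t) 0 - qc (F t) 1 * qc (G t) 1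
    - qc (F t) 2 * qc (G t) 2 - qc (F t) 3 * qc (G t) 3)); last first.
    by apply/funext => t; rewrite !mxE.
  by apply: is_derive_eq; rewrite !qcE; ring.
- rewrite (_ : (fun t => _) = (fun t => qc (F t) 0 * qc (G t) 1 + qc (F t) 1 * qc (G t) 0
    + qc (F t) 2 * qc (G t) 3 - qc (F t) 3 * qc (G t) 2)); last first.
    by apply/funext => t; rewrite !mxE.
  by apply: is_derive_eq; rewrite !qcE; ring.
- rewrite (_ : (fun t => _) = (fun t => qc (F t) 0 * qc (G t) 2 - qc (F t) 1 * qc (G t) 3
    + qc (F t) 2 * qc (G t) 0 + qc (F t) 3 * qc (G t) 1)); last first.
    by apply/funext => t; rewrite !mxE.
  by apply: is_derive_eq; rewrite !qcE; ring.
- rewrite (_ : (fun t => _) = (fun t => qc (F t) 0 * qc (G t) 3 + qc (F t) 1 * qc (G t) 2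
    - qc (F t) 2 * qc (G t) 1 + qc (F t) 3 * qc (G t) 0)); last first.
    by apply/funext => t; rewrite !mxE.
  by apply: is_derive_eq; rewrite !qcE; ring.
Qed.

Lemma is_derive_qmull (q : quat R) F x v dF : is_derive x v F dF ->
  is_derive x v (fun t => qmul q (F t)) (qmul q dF).
Proof.
move=> d; have := is_derive_qmul (is_derive_cst q x v) d.
by rewrite qmul0l add0r.
Qed.

Lemma is_derive_qmulr (q : quat R) F x v dF : is_derive x v F dF ->
  is_derive x v (fun t => qmul (F t) q) (qmul dF q).
Proof.
move=> d; have := is_derive_qmul d (is_derive_cst q x v).
by rewrite qmul0r addr0.
Qed.

Lemma is_derive_qmk (a b c d : V -> R) x v (a' b' c' d' : R) :
  is_derive x v a a' -> is_derive x v b b' ->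
  is_derive x v c c' -> is_derive x v d d' ->
  is_derive x v (fun t => qmk (a t) (b t) (c t) (d t)) (qmk a' b' c' d').
Proof.
move=> da db dc dd; apply/is_derive_mxP => i j.
rewrite (ord1 i).
rewrite (_ : (fun t => _) = (fun t => [:: a t; b t; c t; d t]`_j)); last first.
  by apply/funext => t; rewrite mxE.
by rewrite mxE; case: j => -[|[|[|[|]]]].
Qed.

Lemma is_derive_ej (th : V -> R) x v (d : R) : is_derive x v th d ->
  is_derive x v (fun t => ej (th t)) (d *: qmul qj (ej (th x))).
Proof.
move=> dth; have -> : d *: qmul qj (ej (th x)) =
    qmk (- sin (th x) * d) 0 (cos (th x) * d) 0.
  by rewrite /qj /ej; qring.
apply: is_derive_qmk (is_derive_cst (0 : R) x v) _ (is_derive_cst (0 : R) x v).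
  exact: (is_derive_chain dth (is_derive_cos (th x))).
exact: (is_derive_chain dth (is_derive_sin (th x))).
Qed.

End QuaternionCalculus.

(** * Linear phases, smoothness and harmonicity on the plane *)

Section PlaneCalculus.
Set Implicit Arguments.
Unset Strict Implicit.
Context {R : realType}.
Implicit Types (F : cpt R -> quat R) (x v z b : cpt R).

Lemma is_derive_ip b z v : is_derive z v (ip b) (ip b v).
Proof.
have dc (i : 'I_2) : is_derive z v (fun y : cpt R => y 0 i) (v 0 i).
  exact: (is_derive_mxP (@id (cpt R)) z v v).1.
rewrite (_ : ip b = (fun y => b 0 0 *: (y 0 0 : R) + b 0 1 *: (y 0 1 : R))) //.
by apply: is_deriveD; apply: is_deriveZ.
Qed.

Lemma is_derive_lag_angle b z v : is_derive z v (lag_angle b) (lag_angle b v).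
Proof. by apply: (@is_deriveZ _ _ _ _ (2 * pi)); exact: is_derive_ip. Qed.

Lemma lag_angleD b z v : lag_angle b (z + v) = lag_angle b z + lag_angle b v.
Proof. by rewrite /lag_angle /ip !mxE; ring. Qed.

Lemma lag_angle0 b : lag_angle b 0 = 0.
Proof. by rewrite /lag_angle /ip !mxE; ring. Qed.

Lemma is_derive_ejlag b z v (k : R) :
  is_derive z v (fun t => ej (k * lag_angle b t))
    ((k * lag_angle b v) *: qmul qj (ej (k * lag_angle b z))).
Proof.
by apply: is_derive_ej; apply: is_deriveZ; exact: is_derive_lag_angle.
Qed.

Lemma continuous_qmull (q : quat R) : continuous (qmul q).
Proof.
rewrite (_ : qmul q = fun p => qc p 0 *: q + qc p 1 *: qmul q qi +
  qc p 2 *: qmul q qj + qc p 3 *: qmul q qk); last first.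
  by apply/funext => p; rewrite /qi /qj /qk; qring.
have cc n : continuous (fun p : quat R => qc p n) by move=> p; exact: coord_continuous.
have cz n (w : quat R) : continuous (fun p : quat R => qc p n *: w).
  by move=> p; exact: (cvgZr_tmp (cc n p)).
by move=> p; apply: (cvgD (cvgD (cvgD (cz 0%N q p) (cz 1%N _ p)) (cz 2%N _ p)) (cz 3%N _ p)).
Qed.

(** This keeps rotated translates of holomorphic sections smooth. Differentiation commutes with the
    translation and with the constant left factor, which drives the induction on [k]. *)
Lemma Ck_qmull_shift (q : quat R) (t : cpt R) k F :
  Ck k F -> Ck k (fun z => qmul q (F (z + t))).
Proof.
have dF F' z v : derivable F' (z + t) v ->
    is_derive z v (fun y => qmul q (F' (y + t))) (qmul q ('D_v F' (z + t))).
  by move=> /derivableP d; apply: is_derive_qmull; exact: ((is_derive_shiftr F' z t v _).1 d).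
elim: k F => [|k IH] F /=.
  move=> cF z; apply: (@continuous_comp _ _ _ (fun z => F (z + t)) (qmul q)).
    apply: (@continuous_comp _ _ _ (fun z => z + t) F); last exact: cF.
    have hid : (y @[y --> z] --> z)%classic by exact: cvg_id.
    have hc : ((fun=> t) @ nbhs z --> t)%classic by exact: cvg_cst.
    exact: (cvgD hid hc).
  exact: continuous_qmull.
move=> [dF12 [c1 c2]]; split.
  by move=> z; have [d1 d2] := dF12 (z + t); split; [have [] := dF _ _ _ d1|have [] := dF _ _ _ d2].
have E1 : (fun z => qmul q ('D_e1 F (z + t))) = 'D_e1 (fun z => qmul q (F (z + t))).
  by apply/funext => z; have [_] := dF _ _ _ (dF12 (z + t)).1; exact: esym.
have E2 : (fun z => qmul q ('D_e2 F (z + t))) = 'D_e2 (fun z => qmul q (F (z + t))).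
  by apply/funext => z; have [_] := dF _ _ _ (dF12 (z + t)).2; exact: esym.
split.
  exact: (eq_ind _ (Ck k) (IH ('D_e1 F) c1) _ E1).
exact: (eq_ind _ (Ck k) (IH ('D_e2 F) c2) _ E2).
Qed.

Lemma Ck_cst (c : R) k : Ck k (fun _ : cpt R => c).
Proof.
have D0 v : 'D_v (fun _ : cpt R => c) = fun=> 0.
  by apply/funext => z; rewrite (derive_cst c).
have cc : continuous (fun _ : cpt R => c) by move=> z; apply: cst_continuous.
elim: k c cc D0 => [|k IH] c cc D0 //=.
split; first by move=> z; split; exact: derivable_cst.
have C0 : continuous (fun _ : cpt R => 0 : R) by move=> z; apply: cst_continuous.
by rewrite !D0; split; apply: IH => // v; apply/funext => z; rewrite (derive_cst 0).
Qed.

(** The function is affine: its first derivatives are constant and all later ones vanish. *)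
Lemma harmonic_lag_angle b (c : R) : Defs.harmonic (fun z => lag_angle b z + c).
Proof.
have d z v : is_derive z v (fun z => lag_angle b z + c) (lag_angle b v).
  rewrite -[lag_angle b v]addr0.
  exact: (is_deriveD (is_derive_lag_angle b z v) (is_derive_cst c z v)).
have D v : 'D_v (fun z => lag_angle b z + c) = fun=> lag_angle b v.
  by apply/funext => z; have [_ ->] := d z v.
split; last first.
  by move=> z; rewrite !D (derive_cst (lag_angle b e1)) (derive_cst (lag_angle b e2)) addr0.
case=> [|k] /=.
  have cr (r : R) : continuous (fun _ : cpt R => r) by move=> z; apply: cst_continuous.
  have cc (i : 'I_2) (r : R) z : {for z, continuous (fun y : cpt R => r * y 0 i)}.
    exact: (cvgM (cr r z) (@coord_continuous _ _ _ 0 i z)).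
  move=> z; exact: (cvgD (cvgM (cr (2 * pi) z) (cvgD (cc 0 _ z) (cc 1 _ z))) (cr c z)).
split; first by move=> z; split; [have [] := d z e1|have [] := d z e2].
by rewrite !D; split; exact: Ck_cst.
Qed.

Lemma smooth_derivable F z : smooth F -> derivable F z e1 /\ derivable F z e2.
Proof. by move=> /(_ 1%N) [/(_ z)]. Qed.

Lemma smooth_derive F : smooth F -> smooth ('D_e1 F) /\ smooth ('D_e2 F).
Proof. by move=> sF; split => k; have [_ []] := sF k.+1. Qed.

(** The mean value argument concerns real functions, so the symmetry is obtained coordinate by
    coordinate. *)
Lemma smooth_schwarz F z : smooth F -> 'D_e2 ('D_e1 F) z = 'D_e1 ('D_e2 F) z.
Proof.
move=> sF; have [s1 s2] := smooth_derive sF.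
have [[_ s12] [s21 _]] := (smooth_derive s1, smooth_derive s2).
have Dq v n : (forall y, derivable F y v) -> 'D_v (fun y => qc (F y) n) = fun y => qc ('D_v F y) n.
  move=> dF; apply/funext => y.
  by have /is_derive_qcP/(_ n)[_ ->] := derivableP (dF y).
have D1 := fun n => Dq e1 n (fun y => (smooth_derivable y sF).1).
have D2 := fun n => Dq e2 n (fun y => (smooth_derivable y sF).2).
have dq (G : cpt R -> quat R) n y v : derivable G y v -> derivable (fun y => qc (G y) n : R) y v.
  by move=> /derivableP/is_derive_qcP/(_ n)[].
have qE (G : cpt R -> quat R) v n y : derivable G y v ->
    qc ('D_v G y) n = 'D_v (fun y => qc (G y) n) y.
  by move=> /derivableP/is_derive_qcP/(_ n)[_ ->].
have cq (G : cpt R -> quat R) n : continuous G -> continuous (fun y => qc (G y) n).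
  by move=> cG y; exact: (@continuous_comp _ _ _ G (fun q : quat R => qc q n) y
    (cG y) (@coord_continuous _ _ _ _ _ (G y))).
have E n : qc ('D_e2 ('D_e1 F) z) n = qc ('D_e1 ('D_e2 F) z) n.
  apply: (etrans (qE ('D_e1 F) e2 n z (smooth_derivable z s1).2)).
  apply: (etrans _ (esym (qE ('D_e2 F) e1 n z (smooth_derivable z s2).1))).
  apply: (etrans (congr1 (fun g => 'D_e2 g z) (esym (D1 n)))).
  apply: (etrans _ (congr1 (fun g => 'D_e1 g z) (D2 n))).
  apply: schwarz.
  - by move=> y; apply: dq; exact: (smooth_derivable y sF).1.
  - by move=> y; apply: dq; exact: (smooth_derivable y sF).2.
  - by move=> y; rewrite (D1 n); apply: dq; exact: (smooth_derivable y s1).2.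
  - by move=> y; rewrite (D2 n); apply: dq; exact: (smooth_derivable y s2).1.
  - have -> : 'D_e2 ('D_e1 (fun y => qc (F y) n)) = fun y => qc ('D_e2 ('D_e1 F) y) n.
      by apply: (etrans (congr1 (fun g => 'D_e2 g) (D1 n))); apply/funext => y;
        exact: (esym (qE ('D_e1 F) e2 n y (smooth_derivable y s1).2)).
    exact: (cq _ n (s12 0%N)).
  - have -> : 'D_e1 ('D_e2 (fun y => qc (F y) n)) = fun y => qc ('D_e1 ('D_e2 F) y) n.
      by apply: (etrans (congr1 (fun g => 'D_e1 g) (D2 n))); apply/funext => y;
        exact: (esym (qE ('D_e2 F) e1 n y (smooth_derivable y s2).1)).
    exact: (cq _ n (s21 0%N)).
by apply: quatP.
Qed.

End PlaneCalculus.

(** * The left normal of a Darboux transform *)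

Section DarbouxNormal.
Set Implicit Arguments.
Unset Strict Implicit.
Context {R : realType}.
Implicit Types (z v : cpt R) (f a T : cpt R -> quat R).

(** With [X = f_x] and [XX = f_xx], the left side is the [e2]-derivative of [f - W f_x], and the
    right side is [W N W^-1] times its [e1]-derivative. The terms in [XX] agree since [S W = 1];
    those in [X] are handled by [conj_normal_identity]. *)
Lemma darboux_derivative_identity (S W N X XX : quat R) (p1 p2 : R) :
  qmul W S = qreal 1 -> qmul S W = qreal 1 -> qc N 0 = 0 -> qc N 2 = 0 ->
  qmul (S - p1 *: qj) (qmul N S - p2 *: qj) =
    qmul (qmul N S - p2 *: qj) (S - p1 *: qj) ->
  qmul N X - (qmul (p2 *: (qmul qj W - qmul W qj)) X +
    qmul W (qmul ((2 * p1) *: qmul qj N) X + qmul N XX)) =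
  qmul (qmul W (qmul N S))
    (X - (qmul (p1 *: (qmul qj W - qmul W qj)) X + qmul W XX)).
Proof.
move=> WS SW N0 N2 comm.
have key := conj_normal_identity WS SW N0 N2 comm.
set Y := qmul qj W - _ in key *.
rewrite [in RHS]qmulDr qmulNr [in RHS]qmulDr.
have -> : qmul (qmul W (qmul N S)) (qmul W XX) = qmul W (qmul N XX).
  by rewrite !qmulA -(qmulA _ S W) SW qmul1r.
move: (congr1 (fun q => qmul q X) key) => /=.
rewrite -qmulA (qmulDl (qreal 1)) qmul1l qmulNl qmulDr qmulNr => E.
rewrite [in RHS]opprD addrA -E.
rewrite qmulDl qmulNl (qmulDl (p2 *: Y)) qmulDr !opprD !addrA.
by rewrite -!qmulA.
Qed.

Lemma is_derive_half_ej (b0 : cpt R) z v :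
  is_derive z v (fun t => ej (lag_angle b0 t / 2))
    ((lag_angle b0 v / 2) *: qmul qj (ej (lag_angle b0 z / 2))).
Proof.
have := is_derive_ejlag b0 z v 2^-1.
rewrite (_ : (fun t => _) = fun t => ej (lag_angle b0 t / 2)).
  by rewrite ![2^-1 * _]mulrC.
by apply/funext => t; rewrite mulrC.
Qed.

Lemma is_derive_half_ejN (b0 : cpt R) z v :
  is_derive z v (fun t => ej (- (lag_angle b0 t / 2)))
    (- ((lag_angle b0 v / 2) *: qmul qj (ej (- (lag_angle b0 z / 2))))).
Proof.
have := is_derive_ejlag b0 z v (- 2^-1).
rewrite (_ : (fun t => _) = fun t => ej (- (lag_angle b0 t / 2))).
  by rewrite !mulNr ![2^-1 * _]mulrC scaleNr.
by apply/funext => t; rewrite mulNr mulrC.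
Qed.

(** Conjugating a constant by [e^{j beta/2}] has as derivative the commutator with [j dbeta/2],
    because [j] commutes with [e^{j beta/2}]. *)
Lemma is_derive_rotated (b0 : cpt R) (C : quat R) z v :
  let W t := qmul (ej (lag_angle b0 t / 2)) (qmul C (ej (- (lag_angle b0 t / 2)))) in
  is_derive z v W ((lag_angle b0 v / 2) *: (qmul qj (W z) - qmul (W z) qj)).
Proof.
move=> W; rewrite /W.
have := is_derive_qmul (is_derive_half_ej b0 z v)
  (is_derive_qmull C (is_derive_half_ejN b0 z v)).
set D := (X in is_derive z v _ X -> _); set D' := (X in _ -> is_derive z v _ X).
suff -> : D = D' by move=> d; exact: d.
rewrite /D /D' !(qmulNr, qmulZl, qmulZr) -scalerBr; congr (_ *: (_ - _)); rewrite -!qmulA //.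
by rewrite ej_qj.
Qed.

Lemma is_derive_normal (b0 : cpt R) z v :
  is_derive z v (normal_f b0) (lag_angle b0 v *: qmul qj (normal_f b0 z)).
Proof.
have := is_derive_qmulr qi (is_derive_ejlag b0 z v 1).
rewrite (_ : (fun t => _) = normal_f b0).
  by rewrite !mul1r qmulZl -qmulA.
by apply/funext => t; rewrite mul1r.
Qed.

Lemma darboux_left_normal (b0 : cpt R) f a T (S : quat R) :
  smooth f ->
  (forall z, 'D_e1 f z != 0 /\ 'D_e2 f z = qmul (normal_f b0 z) ('D_e1 f z)) ->
  (forall z, 'D_e1 a z = qmul (ej (lag_angle b0 z / 2))
     (qmul S (qmul (ej (- (lag_angle b0 z / 2))) (a z)))) ->
  qmul (S - (lag_angle b0 e1 / 2) *: qj) (qmul qi S - (lag_angle b0 e2 / 2) *: qj) =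
    qmul (qmul qi S - (lag_angle b0 e2 / 2) *: qj) (S - (lag_angle b0 e1 / 2) *: qj) ->
  nowhere_zero a -> darboux_T f a T ->
  exists bh : R, forall z, T z != 0 ->
    left_normal_at (darboux f T) (qmul (ej (lag_angle b0 z + bh)) qi) z.
Proof.
move=> sf df da comm a0 dT.
pose E z := ej (lag_angle b0 z / 2); pose E' z := ej (- (lag_angle b0 z / 2)).
have EE' z : qmul (E z) (E' z) = qreal 1 by rewrite /E /E' ejNK.
have E'E z : qmul (E' z) (E z) = qreal 1 by rewrite /E /E' ejNK.
have fT z : qmul ('D_e1 f z) (T z) = - qmul (E z) (qmul S (E' z)).
  apply: (qmulIr (a0 z)); have [+ _] := dT z; rewrite da qmulNl -!qmulA -/(E z) -/(E' z).
  by move=> ->; rewrite opprK.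
(* If [S = 0] then [T] vanishes everywhere, so the claim is vacuous and any angle will do. *)
have [S0|S0] := eqVneq S 0.
  exists 0 => z /eqP[]; apply: (qmulI (df z).1).
  by rewrite fT S0 qmul0l !qmul0r oppr0.
have [t tE] := conj_qi_angle S0 comm.
pose C := qinv S.
pose W z := qmul (E z) (qmul C (E' z)).
have TV z : qinv (T z) = - qmul (W z) ('D_e1 f z).
  apply: qinv_unique; apply: (qmulI (df z).1).
  rewrite qmulA fT qmul1r qmulNl qmulNr opprK /W !qmulA.
  rewrite -(qmulA _ (E' z) (E z)) E'E qmul1r -(qmulA _ S C) qmulV// qmul1r.
  by rewrite EE' qmul1l.
have fhat : darboux f T = fun z => f z - qmul (W z) ('D_e1 f z).
  by apply/funext => z; rewrite /darboux TV.
have [sf1 sf2] := smooth_derive sf.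
(* Symmetry of mixed derivatives turns [f_xy] into the [e1]-derivative of [f_y = N f_x], so only
   [f_x] and [f_xx] remain. *)
have dfy z : 'D_e2 ('D_e1 f) z = qmul (lag_angle b0 e1 *: qmul qj (normal_f b0 z)) ('D_e1 f z)
    + qmul (normal_f b0 z) ('D_e1 ('D_e1 f) z).
  rewrite (smooth_schwarz z sf).
  have -> : 'D_e2 f = fun z => qmul (normal_f b0 z) ('D_e1 f z).
    by apply/funext => y; have [_ ->] := df y.
  have [_ ->] // := is_derive_qmul (is_derive_normal b0 z e1)
    (derivableP (smooth_derivable z sf1).1).
have d1 z : is_derive z e1 (darboux f T) ('D_e1 f z -
    (qmul ((lag_angle b0 e1 / 2) *: (qmul qj (W z) - qmul (W z) qj)) ('D_e1 f z)
     + qmul (W z) ('D_e1 ('D_e1 f) z))).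
  rewrite fhat.
  exact: (is_deriveB (derivableP (smooth_derivable z sf).1)
    (is_derive_qmul (is_derive_rotated b0 C z e1) (derivableP (smooth_derivable z sf1).1))).
have d2 z : is_derive z e2 (darboux f T) ('D_e2 f z -
    (qmul ((lag_angle b0 e2 / 2) *: (qmul qj (W z) - qmul (W z) qj)) ('D_e1 f z)
     + qmul (W z) ('D_e2 ('D_e1 f) z))).
  rewrite fhat.
  exact: (is_deriveB (derivableP (smooth_derivable z sf).2)
    (is_derive_qmul (is_derive_rotated b0 C z e2) (derivableP (smooth_derivable z sf1).2))).
(* The constant [t] comes from [S^-1 i S = e^{jt} i]. From here on everything is conjugated by
   [E z], which carries [S] to [S'] and [i] to [N]. *)
exists t => z _.
pose S' := qmul (E z) (qmul S (E' z)); pose N := normal_f b0 z.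
have NE : N = qmul (E z) (qmul qi (E' z)) by exact: ej_split.
have conjM p q : qmul (qmul (E z) (qmul p (E' z))) (qmul (E z) (qmul q (E' z))) =
    qmul (E z) (qmul (qmul p q) (E' z)).
  by rewrite !qmulA -(qmulA _ (E' z) (E z)) E'E qmul1r.
have conj1 : qmul (E z) (qmul (qreal 1) (E' z)) = qreal 1 by rewrite qmul1l EE'.
have conjB p q (k : R) : q = qj -> qmul (E z) (qmul p (E' z)) - k *: q =
    qmul (E z) (qmul (p - k *: q) (E' z)).
  move=> ->; rewrite (qmulDl p) qmulNl qmulDr qmulNr; congr (_ - _).
  by rewrite qmulZl qmulZr qmulA [qmul (E z) qj]ej_qj -qmulA EE' qmul1r.
have WS : qmul (W z) S' = qreal 1 by rewrite conjM qmulVl// conj1.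
have SW : qmul S' (W z) = qreal 1 by rewrite conjM qmulV// conj1.
have NS : qmul N S' = qmul (E z) (qmul (qmul qi S) (E' z)) by rewrite NE conjM.
have N0 : qc N 0 = 0 by rewrite /N /normal_f /ej /qi !qcE; ring.
have N2 : qc N 2 = 0 by rewrite /N /normal_f /ej /qi !qcE; ring.
(* Conjugation by [E z] fixes [j], so the relation [comm] carries over to [S'] and [N]. *)
have comm' : qmul (S' - (lag_angle b0 e1 / 2) *: qj) (qmul N S' - (lag_angle b0 e2 / 2) *: qj) =
    qmul (qmul N S' - (lag_angle b0 e2 / 2) *: qj) (S' - (lag_angle b0 e1 / 2) *: qj).
  by rewrite NS !conjB// !conjM comm.
have hN : qmul (ej (lag_angle b0 z + t)) qi = qmul (W z) (qmul N S').
  rewrite NS conjM tE -qmulA qi_ej opprK !qmulA -!ejD; congr (qmul (ej _) _).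
  by rewrite addrAC -splitr.
(* The new normal squares to -1, so the second left normal equation follows from the first. *)
have hN2 : qmul (qmul (W z) (qmul N S')) (qmul (W z) (qmul N S')) = - qreal 1.
  rewrite -hN -qmulA (qmulA qi) qi_ej -(qmulA _ qi) qi_sqr qmulA ejNK qmul1l.
  by rewrite ?qmulNr ?qmul1r.
have D12 : 'D_e2 (darboux f T) z = qmul (qmul (W z) (qmul N S')) ('D_e1 (darboux f T) z).
  have [_ ->] := d1 z; have [_ ->] := d2 z.
  rewrite dfy (df z).2 -(darboux_derivative_identity _ _ WS SW N0 N2 comm').
  by rewrite mulrCA mulfV ?mulr1 ?pnatr_eq0.
split; [by have [] := d1 z|by have [] := d2 z|by rewrite hN|].
by rewrite hN D12 qmulA hN2 qmulNl qmul1l.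
Qed.

(** Generic and monochromatic sections both enter through this form. The constant [S] of
    [darboux_left_normal] is [(beta_x/2) j + q m1 q^-1]. *)
Lemma exponential_section_left_normal (w1 w2 b0 : cpt R) f a T (q : quat R)
    (x : cpt R -> cpt R) (m1 m2 : cpt R) :
  HS_torus w1 w2 b0 f -> holomorphic b0 a -> nowhere_zero a -> darboux_T f a T ->
  (forall z, a z = qmul (ej (lag_angle b0 z / 2)) (qmul q (cplx (x z)))) ->
  (forall z, 'D_e1 a z = (lag_angle b0 e1 / 2) *: qmul qj (a z) + qmul (a z) (cplx m1)) ->
  (forall z, 'D_e2 a z = (lag_angle b0 e2 / 2) *: qmul qj (a z) + qmul (a z) (cplx m2)) ->
  exists bh : R, forall z, T z != 0 ->
    left_normal_at (darboux f T) (qmul (ej (lag_angle b0 z + bh)) qi) z.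
Proof.
move=> [_ _ sf _ [g dfg]] [_ hol] a0 dT ax da1 da2.
have q0 : q != 0.
  by apply: contraNneq (a0 0) => q0; rewrite ax q0 qmul0l qmul0r.
pose U m := qmul q (qmul (cplx m) (qinv q)).
have dlog p m z : p *: qmul qj (a z) + qmul (a z) (cplx m) =
    qmul (ej (lag_angle b0 z / 2))
     (qmul (p *: qj + U m) (qmul (ej (- (lag_angle b0 z / 2))) (a z))).
  rewrite (qmulDl (p *: qj)) qmulDr qmulZl qmulZr; congr (p *: _ + _).
    by rewrite (qmulA _ qj) ej_qj -qmulA (qmulA (ej _)) ejNK qmul1l.
  rewrite ax (qmulA (ej (- _))) ejNK qmul1l /U -!qmulA; congr (qmul _ _); congr (qmul _ _).
  by rewrite (qmulA (qinv q)) qmulVl// qmul1l cplxM_comm.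
pose S := (lag_angle b0 e1 / 2) *: qj + U m1.
(* Holomorphicity is evaluated at the origin, where [beta = 0] and the left normal is [i]; the
   factor [a 0] cancels. *)
have S2 : qmul qi S = (lag_angle b0 e2 / 2) *: qj + U m2.
  have [+ _] := hol 0; rewrite da1 da2 !dlog /normal_f lag_angle0 mul0r oppr0 ej0 !qmul1l.
  by rewrite qmulA => /(qmulIr (a0 0)) ->.
have UU : qmul (U m1) (U m2) = qmul (U m2) (U m1).
  rewrite /U -!qmulA; congr (qmul _ _).
  rewrite !(qmulA (qinv q)) qmulVl// !qmul1l.
  by rewrite !(qmulA (cplx _)) cplxM_comm.
apply: (@darboux_left_normal b0 f a T S) => //.
- move=> z; have [g0 -> ->] := dfg z; split.
    apply: contraNneq g0 => e; apply/eqP/(qmulI (ej_neq0 (lag_angle b0 z / 2))).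
    by rewrite e qmul0r.
  rewrite /normal_f ej_split -!qmulA; congr (qmul _ _); congr (qmul _ _).
  by rewrite (qmulA (ej (- _))) ejNK qmul1l.
- by move=> z; rewrite da1 dlog.
- by rewrite S2 /S ![_ + U _]addrC !addrK UU.
Qed.

End DarbouxNormal.

(** * Exponential form of generic and monochromatic sections *)

Section Sections.
Set Implicit Arguments.
Unset Strict Implicit.
Context {R : realType}.
Implicit Types (z v t : cpt R) (a : cpt R -> quat R).

(** The left factor intertwines the normals at [z + t] and [z]: passing it through [i] inverts it,
    which absorbs the whole [beta(t)]. The multiplier acts on the right and is unaffected. *)
Lemma translate_in_H0 (w1 w2 b0 : cpt R) (h : cpt R -> cpt R) a t :
  in_H0 w1 w2 b0 h a ->
  in_H0 w1 w2 b0 h (fun z => qmul (ej (- (lag_angle b0 t / 2))) (a (z + t))).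
Proof.
move=> [[sa hol] per]; set Q := ej _.
have D v z : derivable a (z + t) v ->
    'D_v (fun z => qmul Q (a (z + t))) z = qmul Q ('D_v a (z + t)).
  move=> /derivableP d.
  by have [_ ->] := is_derive_qmull Q ((is_derive_shiftr a z t v _).1 d).
have NQ z p : qmul Q (qmul (normal_f b0 (z + t)) p) = qmul (normal_f b0 z) (qmul Q p).
  rewrite /normal_f lag_angleD !qmulA; congr (qmul _ p).
  rewrite -(qmulA _ qi) qi_ej opprK !qmulA -!ejD; congr (qmul (ej _) _).
  by rewrite [X in _ + (_ + X)]splitr; ring.
split.
  split; first by move=> k; exact: Ck_qmull_shift.
  move=> z; have [d1 d2] := smooth_derivable (z + t) sa.
  suff H p1 p2 : p1 = qmul Q ('D_e1 a (z + t)) -> p2 = qmul Q ('D_e2 a (z + t)) ->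
      p2 = qmul (normal_f b0 z) p1 /\ - p1 = qmul (normal_f b0 z) p2.
    exact: (H _ _ (D e1 z d1) (D e2 z d2)).
  have [E1 E2] := hol (z + t).
  by move=> -> ->; split; [rewrite E1 NQ|rewrite -qmulNr E2 NQ].
by move=> z g gL; rewrite -qmulA -(per _ _ gL) (addrAC z).
Qed.

Lemma generic_section_exponential (w1 w2 b0 : cpt R) (h : cpt R -> cpt R) a :
  generic_spec w1 w2 b0 h -> in_H0 w1 w2 b0 h a -> nowhere_zero a ->
  exists (x : cpt R -> cpt R), [/\ cplx (x 0) = qreal 1,
    (forall z t, a (z + t) =
      qmul (ej (lag_angle b0 t / 2)) (qmul (a z) (cplx (x t)))) &
    forall v, derivable a 0 v -> exists m : cpt R,
      is_derive 0 v (fun t => cplx (x t)) (cplx m)].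
Proof.
move=> [s [_ _ span]] aH a0.
have [c ac] := span _ aH.
have c0 : cplx c != 0.
  by apply: contraNneq (a0 0) => c0; rewrite ac c0 qmul0r.
have [y ys] : exists y : cpt R -> cpt R, forall t z,
    qmul (ej (- (lag_angle b0 t / 2))) (a (z + t)) = qmul (s z) (cplx (y t)).
  have /choice[y ys] := fun t => span _ (translate_in_H0 t aH).
  by exists y.
(* Since [a = s c], the translate [s y(t)] is [a] times [c^-1 y(t)]. *)
have [x xy] : exists x : cpt R -> cpt R,
    forall t, cplx (x t) = qmul (qinv (cplx c)) (cplx (y t)).
  by eexists => t; rewrite cplxV cplxM.
have ax z t : a (z + t) = qmul (ej (lag_angle b0 t / 2)) (qmul (a z) (cplx (x t))).
  apply: (qmulI (ej_neq0 (- (lag_angle b0 t / 2)))).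
  rewrite ys [in RHS]qmulA ejNK qmul1l ac xy -qmulA; congr (qmul _ _).
  by rewrite (qmulA (cplx c)) qmulV// qmul1l.
exists x; split => //.
  apply: (qmulI (a0 0)); rewrite qmul1r.
  by have := ax 0 0; rewrite addr0 lag_angle0 mul0r ej0 qmul1l.
move=> v da.
(* The function [x] was obtained by choice for each [t] separately; solving for it at [z = 0] shows
   that it inherits derivability from [a]. *)
have xE : (fun t => cplx (x t)) = fun t => qmul (qinv (a 0))
    (qmul (ej (- (lag_angle b0 t / 2))) (a t)).
  apply/funext => t.
  have := ax 0 t; rewrite add0r => ->.
  by rewrite (qmulA (ej _)) ejNK qmul1l qmulA qmulVl// qmul1l.
have [M dM] : exists M, is_derive 0 v (fun t => cplx (x t)) M.
  rewrite xE; eexists; apply: is_derive_qmull.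
  exact: (is_derive_qmul (is_derive_half_ejN b0 0 v) (derivableP da)).
have M0 n : (n == 2%N) || (n == 3%N) -> qc M n = 0.
  move=> n23; have /is_derive_qcP/(_ n)[_ <-] := dM.
  rewrite (_ : (fun t => _) = fun=> 0); first exact: (derive_cst 0).
  by apply/funext => t; case/orP: n23 => /eqP ->; rewrite /cplx qc_qmk.
exists (row2 (qc M 0) (qc M 1)).
by rewrite -cplx_row2 ?M0.
Qed.

(** Differentiating [a(z + t) = e^{j beta(t)/2} a(z) x(t)] in [t] at 0 gives [m1] and [m2] as
    derivatives of [x] at 0, hence independent of [z]. *)
Lemma generic_section_derivative (w1 w2 b0 : cpt R) (h : cpt R -> cpt R) a :
  generic_spec w1 w2 b0 h -> in_H0 w1 w2 b0 h a -> nowhere_zero a ->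
  exists (x : cpt R -> cpt R) (m1 m2 : cpt R),
    [/\ forall z, a z = qmul (ej (lag_angle b0 z / 2)) (qmul (a 0) (cplx (x z))),
     forall z, 'D_e1 a z = (lag_angle b0 e1 / 2) *: qmul qj (a z) + qmul (a z) (cplx m1) &
     forall z, 'D_e2 a z = (lag_angle b0 e2 / 2) *: qmul qj (a z) + qmul (a z) (cplx m2)].
Proof.
move=> gen aH a0; have [x [x0 ax dx]] := generic_section_exponential gen aH a0.
have [[sa _] _] := aH.
have D v m z : derivable a z v -> is_derive 0 v (fun t => cplx (x t)) (cplx m) ->
    'D_v a z = (lag_angle b0 v / 2) *: qmul qj (a z) + qmul (a z) (cplx m).
  move=> /derivableP d dm; set D := 'D_v a z in d *.
  have d0 : is_derive (0 + z) v a D by rewrite add0r.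
  have [_ <-] := (is_derive_shiftr a 0 z v D).1 d0.
  have -> : (fun y => a (y + z)) =
      fun t => qmul (ej (lag_angle b0 t / 2)) (qmul (a z) (cplx (x t))).
    by apply/funext => t; rewrite addrC ax.
  have [_ ->] := is_derive_qmul (is_derive_half_ej b0 0 v) (is_derive_qmull (a z) dm).
  by rewrite lag_angle0 mul0r ej0 x0 !qmul1r qmul1l qmulZl.
have [m1 d1] := dx e1 (smooth_derivable 0 sa).1.
have [m2 d2] := dx e2 (smooth_derivable 0 sa).2.
exists x, m1, m2; split => z.
- by rewrite -{1}[z]add0r ax.
- exact: (D e1 m1 z (smooth_derivable z sa).1 d1).
- exact: (D e2 m2 z (smooth_derivable z sa).2 d2).
Qed.

(** The complex factor is the exponential of a real-linear form times [c], so its logarithmic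
    derivative along [v] is the value of that form at [v]: real part [r v], imaginary part
    [th v]. *)
Lemma monochromatic_derivative (b0 A B d c : cpt R) a :
  (forall z, a z = qmul (alpha_d b0 A B d z) (cplx c)) ->
  exists (q : quat R) (x : cpt R -> cpt R) (m : cpt R -> cpt R),
    (forall z, a z = qmul (ej (lag_angle b0 z / 2)) (qmul q (cplx (x z)))) /\
    forall v z, 'D_v a z =
      (lag_angle b0 v / 2) *: qmul qj (a z) + qmul (a z) (cplx (m v)).
Proof.
move=> aE.
pose q := qreal 1 - qmul qk (lambda_d b0 A B d).
pose th z := 2 * pi * ip (d - B) z.
pose r z := 2 * pi * ip A z.
pose X z := qmul (ei (th z)) (qreal (expR (r z))).
have X23 z : qc (qmul (X z) (cplx c)) 2 = 0 /\ qc (qmul (X z) (cplx c)) 3 = 0.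
  by rewrite /X /ei /qreal /cplx !qcE; split; ring.
exists q, (fun z => row2 (qc (qmul (X z) (cplx c)) 0) (qc (qmul (X z) (cplx c)) 1)),
  (fun v => row2 (r v) (th v)).
have aX z : a z = qmul (ej (lag_angle b0 z / 2)) (qmul q (qmul (X z) (cplx c))).
  by rewrite aE /alpha_d -!qmulA.
split => [z|v z]; first by have [X2 X3] := X23 z; rewrite -cplx_row2.
have dth : is_derive z v th (th v) by exact: is_derive_lag_angle.
have dr : is_derive z v r (r v) by exact: is_derive_lag_angle.
have dX : is_derive z v X (qmul (X z) (cplx (row2 (r v) (th v)))).
  pose u t := expR (r t) * cos (th t); pose w t := expR (r t) * sin (th t).
  have XE : X = fun t => qmk (u t) (w t) 0 0.
    by apply/funext => t; rewrite /X /u /w /ei /qreal; qring.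
  have de := is_derive_chain dr (is_derive_expR (r z)).
  have dc := is_derive_chain dth (is_derive_cos (th z)).
  have ds := is_derive_chain dth (is_derive_sin (th z)).
  have := is_derive_qmk (is_deriveM de dc) (is_deriveM de ds)
    (is_derive_cst (0 : R) z v) (is_derive_cst (0 : R) z v).
  set D := (Y in is_derive z v _ Y -> _).
  suff -> : D = qmul (X z) (cplx (row2 (r v) (th v))) by rewrite XE.
  rewrite /D XE /u /w /cplx !row2E; apply: quatP; rewrite !qcE /GRing.scale /=.
  by split; ring.
have -> : a = fun z => qmul (ej (lag_angle b0 z / 2)) (qmul q (qmul (X z) (cplx c))).
  exact/funext.
have [_ ->] := is_derive_qmul (is_derive_half_ej b0 z v)
  (is_derive_qmull q (is_derive_qmulr (cplx c) dX)).
rewrite qmulZl -!qmulA; congr (_ *: _ + qmul _ (qmul _ (qmul _ _))).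
by congr (qmul _ _); exact: cplxM_comm.
Qed.

End Sections.

Theorem theorem3p8 (R : realType) (w1 w2 b0 : cpt R) (f : cpt R -> quat R) :
  lattice_basis w1 w2 -> HS_torus w1 w2 b0 f ->
  (* every Darboux transform given by a section in H^0_h, h generic in Spec,
     is Hamiltonian stationary *)
  (forall (h : cpt R -> cpt R) (a T : cpt R -> quat R),
      multiplier w1 w2 h -> generic_spec w1 w2 b0 h ->
      in_H0 w1 w2 b0 h a -> nowhere_zero a -> darboux_T f a T ->
      HS_off (darboux f T) (fun z => T z != 0)) /\
  (* every monochromatic Darboux transform has left normal e^{j(beta + beta_h)} i *)
  (forall (h : cpt R -> cpt R) (a T : cpt R -> quat R),
      multiplier w1 w2 h -> in_H0 w1 w2 b0 h a -> nowhere_zero a ->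
      monochromatic w1 w2 b0 a -> darboux_T f a T ->
      exists bh : R, forall z, T z != 0 ->
        left_normal_at (darboux f T) (qmul (ej (lag_angle b0 z + bh)) qi) z).
Proof.
move=> _ hf; split => [h a T _ gen aH a0 dT|h a T _ aH a0 [A [B [d [c [_ _ aE]]]]] dT].
  have [x [m1 [m2 [ax d1 d2]]]] := generic_section_derivative gen aH a0.
  have [bh normal] := exponential_section_left_normal hf aH.1 a0 dT ax d1 d2.
  (* The angle [beta + bh] has the same constant [bh] at every point, hence is affine and
     harmonic. *)
  exists (fun z => lag_angle b0 z + bh); split => //.
  exact: harmonic_lag_angle.
have [q [x [m [ax da]]]] := monochromatic_derivative aE.
exact: (exponential_section_left_normal hf aH.1 a0 dT ax (da e1) (da e2)).
Qed.
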